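(* Let $\mathcal{H}$ be a right quaternionic Hilbert space and let $T_1,T_2\in\mathcal{B}_R(\mathcal{H})$ be normal operators. If $S\in\mathcal{B}_R(\mathcal{H})$ satisfies $T_1S=ST_2$, then $T_1^*S=ST_2^*$.
   Context: $\mathcal{H}$ is a right quaternionic Hilbert space (a right vector space over the quaternions $\mathbb{H}$ with a Hermitian quaternionic scalar product $\langle\cdot,\cdot\rangle$, right linear in the first argument, $\overline{\langle x,y\rangle}=\langle y,x\rangle$, positive definite, complete). $\mathcal{B}_R(\mathcal{H})$ is the set of bounded right linear operators $T$ on $\mathcal{H}$ ($T(xq+y)=(Tx)q+Ty$), $T^*$ is the adjoint ($\langle Tx,y\rangle=\langle x,T^*y\rangle$), and $T$ is normal if $TT^*=T^*T$. *)

(* Defs.v *)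
From HB Require Import structures.
From mathcomp Require Import all_boot all_order all_algebra.
From mathcomp Require Import reals.
Set Implicit Arguments. Unset Strict Implicit. Unset Printing Implicit Defensive.
Import Order.TTheory GRing.Theory Num.Theory.
Local Open Scope ring_scope.

Record quat (R : realType) := Quat { qr : R; qi : R; qj : R; qk : R }.

Section QuatOps.
Variable R : realType.
Definition qzero : quat R := Quat 0 0 0 0.
Definition qone : quat R := Quat 1 0 0 0.
Definition qadd (p q : quat R) : quat R :=
  Quat (qr p + qr q) (qi p + qi q) (qj p + qj q) (qk p + qk q).
Definition qopp (p : quat R) : quat R := Quat (- qr p) (- qi p) (- qj p) (- qk p).
(* Hamilton product: i^2 = j^2 = k^2 = ijk = -1 *)
Definition qmul (p q : quat R) : quat R :=
  Quat (qr p * qr q - qi p * qi q - qj p * qj q - qk p * qk q)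
       (qr p * qi q + qi p * qr q + qj p * qk q - qk p * qj q)
       (qr p * qj q - qi p * qk q + qj p * qr q + qk p * qi q)
       (qr p * qk q + qi p * qj q - qj p * qi q + qk p * qr q).
Definition qconj (p : quat R) : quat R := Quat (qr p) (- qi p) (- qj p) (- qk p).
End QuatOps.

Record qhilbert (R : realType) := QHilbert {
  qh_V :> zmodType;
  qh_sm : qh_V -> quat R -> qh_V;
  qh_ip : qh_V -> qh_V -> quat R;
  qh_sm1 : forall x, qh_sm x (qone R) = x;
  qh_smA : forall x p q, qh_sm (qh_sm x p) q = qh_sm x (qmul p q);
  qh_smDv : forall x y q, qh_sm (x + y) q = qh_sm x q + qh_sm y q;
  qh_smDs : forall x p q, qh_sm x (qadd p q) = qh_sm x p + qh_sm x q;
  qh_ipD : forall x y z, qh_ip (x + y) z = qadd (qh_ip x z) (qh_ip y z);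
  qh_ipZ : forall x z q, qh_ip (qh_sm x q) z = qmul (qh_ip x z) q;
  qh_ipC : forall x y, qconj (qh_ip x y) = qh_ip y x;
  (* positive definite (<x,x> is real by qh_ipC) *)
  qh_ip_ge0 : forall x, 0 <= qr (qh_ip x x);
  qh_ip_eq0 : forall x, qh_ip x x = qzero R -> x = 0;
  qh_complete : forall u : nat -> qh_V,
    (forall e : R, 0 < e -> exists N, forall m n, (N <= m)%N -> (N <= n)%N ->
        Num.sqrt (qr (qh_ip (u m - u n) (u m - u n))) < e) ->
    exists l, forall e : R, 0 < e -> exists N, forall n, (N <= n)%N ->
        Num.sqrt (qr (qh_ip (u n - l) (u n - l))) < e
}.

Section Operators.
Variables (R : realType) (H : qhilbert R).

Definition qnorm (x : H) : R := Num.sqrt (qr (qh_ip x x)).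

Definition bounded_rlinear (T : H -> H) : Prop :=
  (forall x y : H, T (x + y) = T x + T y) /\
  (forall (x : H) (q : quat R), T (qh_sm x q) = qh_sm (T x) q) /\
  (exists C : R, forall x : H, qnorm (T x) <= C * qnorm x).

(* Ts is the adjoint T^* of T: <T x, y> = <x, Ts y> (unique when it exists) *)
Definition is_adjoint (T Ts : H -> H) : Prop :=
  forall x y : H, qh_ip (T x) y = qh_ip x (Ts y).

Definition normal_op (T Ts : H -> H) : Prop := T \o Ts = Ts \o T.
End Operators.

(* Main.v *)
(** The right multiplication by the quaternions a + b i turns H into a complex
    Hilbert space on which T1, T2, S act linearly. Rosenblum's argument, that
    exp(mu T1s) S exp(- mu T2s) is a bounded entire function of mu, is
    carried out with (1 + mu T1s)^n S (1 - mu T2s)^n in place of exponentials.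
    Normality gives |(1 + mu T1s) x| = |(1 + nu T1) x| for nu the conjugate of
    mu, and with T1 S = S T2 this bounds the polynomial by 4 |S| on the circle
    |mu| = 1 / (2 c m), where n = m^2 and c bounds T1 and T2. Its linear
    coefficient is n (T1s S - S T2s), so Cauchy's estimate gives
    m |T1s S - S T2s| <= 8 c |S| for all m. Cauchy's estimate for polynomials
    only needs square roots: p(w) + p(-w) and p(w) - p(-w) halve the degree. *)
Require Import Defs.
From mathcomp Require Import all_boot all_order all_algebra.
From mathcomp Require Import reals boolp ring lra.
Set Implicit Arguments. Unset Strict Implicit. Unset Printing Implicit Defensive.
Import Order.TTheory GRing.Theory Num.Theory.
Local Open Scope ring_scope.

(** * Real scalar product and complex scalars on the quaternionic space *)

Section RealStructure.
Variables (R : realType) (H : qhilbert R).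
Implicit Types (x y z : H) (l m : R * R).

Definition rdot x y : R := qr (qh_ip x y).

Lemma rdotC x y : rdot x y = rdot y x.
Proof. by rewrite /rdot -(qh_ipC x y). Qed.

Lemma rdotDl x y z : rdot (x + y) z = rdot x z + rdot y z.
Proof. by rewrite /rdot qh_ipD. Qed.

Lemma rdotDr x y z : rdot x (y + z) = rdot x y + rdot x z.
Proof. by rewrite rdotC rdotDl !(rdotC x). Qed.

(** Complex numbers are kept as pairs of reals and embedded in the quaternions as the plane spanned
    by 1 and i. *)
Definition csm l x : H := qh_sm x (Quat l.1 l.2 0 0).

Lemma csmD l x y : csm l (x + y) = csm l x + csm l y.
Proof. exact: qh_smDv. Qed.

Lemma csm0 l : csm l 0 = 0.
Proof. by apply: (addrI (csm l 0)); rewrite -csmD !addr0. Qed.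

Lemma csmN l x : csm l (- x) = - csm l x.
Proof. by apply: (addrI (csm l x)); rewrite -csmD !subrr csm0. Qed.

Lemma csmA l m x :
  csm l (csm m x) = csm (l.1 * m.1 - l.2 * m.2, l.1 * m.2 + l.2 * m.1) x.
Proof. by rewrite /csm qh_smA /qmul /=; congr (qh_sm _ (Quat _ _ _ _)); ring. Qed.

Lemma csmC l m x : csm l (csm m x) = csm m (csm l x).
Proof. by rewrite !csmA; congr csm; congr pair; ring. Qed.

Lemma csmDl l m x : csm l x + csm m x = csm (l.1 + m.1, l.2 + m.2) x.
Proof. by rewrite /csm -qh_smDs /qadd /= !addr0. Qed.

Lemma csm1 x : csm (1, 0) x = x.
Proof. exact: qh_sm1. Qed.

Definition copp l : R * R := (- l.1, - l.2).

Lemma csm_opp l x : csm (copp l) x = - csm l x.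
Proof.
rewrite /copp.
rewrite -[- l.1]mulN1r -[- l.2]mulN1r.
have -> : csm (-1 * l.1, -1 * l.2) x = csm (-1, 0) (csm l x).
  by rewrite csmA /=; congr csm; congr pair; ring.
apply: (addIr (csm l x)); rewrite addNr -{2}(csm1 (csm l x)) csmDl /= addNr addr0.
by apply: (addIr (csm (1, 0) (csm l x))); rewrite csmDl /= !add0r.
Qed.

Definition cconj l : R * R := (l.1, - l.2).

Definition cnorm2 l : R := l.1 ^+ 2 + l.2 ^+ 2.

(** Moving [l] to the other argument multiplies the quaternion [qh_ip x y] by [l] on the left
    instead of the right, and Re(pq) = Re(qp). *)
Lemma rdotZl l x y : rdot (csm l x) y = rdot x (csm (cconj l) y).
Proof.
rewrite /rdot /csm qh_ipZ -(qh_ipC (qh_sm _ _) x) qh_ipZ -(qh_ipC x y) /=.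
by ring.
Qed.

Lemma rdotZr (a : R) x y : rdot x (csm (a, 0) y) = a * rdot x y.
Proof. by rewrite rdotC /rdot /csm qh_ipZ -(qh_ipC x y) /=; ring. Qed.

Lemma rdotZ l x y : rdot (csm l x) (csm l y) = cnorm2 l * rdot x y.
Proof.
rewrite rdotZl csmA -rdotZr /=; congr (rdot _ (csm _ _)).
by rewrite /cnorm2; congr pair; ring.
Qed.

Lemma rdotxx_ge0 x : 0 <= rdot x x.
Proof. exact: qh_ip_ge0. Qed.

(** By [qh_ipC] the quaternion [qh_ip x x] equals its conjugate, so its imaginary parts vanish as
    well. *)
Lemma rdot_eq0 x : rdot x x = 0 -> x = 0.
Proof.
move=> x0; apply: qh_ip_eq0; move: (qh_ipC x x) x0; rewrite /rdot.
case: (qh_ip x x) => a b c d; rewrite /qconj /= => -[hb hc hd] ->.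
by rewrite /qzero; congr Quat; lra.
Qed.

Lemma qnormE x : qnorm x ^+ 2 = rdot x x.
Proof. by rewrite sqr_sqrtr ?rdotxx_ge0. Qed.

Lemma qnorm_ge0 x : 0 <= qnorm x.
Proof. exact: sqrtr_ge0. Qed.

Lemma qnorm_eq0 x : qnorm x = 0 -> x = 0.
Proof. by move=> x0; apply: rdot_eq0; rewrite -qnormE x0 expr0n. Qed.

Lemma eq_qnorm x y : rdot x x = rdot y y -> qnorm x = qnorm y.
Proof. by rewrite /qnorm /rdot => ->. Qed.

Lemma qnormZ l x : qnorm (csm l x) = Num.sqrt (cnorm2 l) * qnorm x.
Proof.
rewrite /qnorm -[qr _]/(rdot _ _) rdotZ sqrtrM //.
by rewrite addr_ge0 ?sqr_ge0.
Qed.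

Lemma rdot_le x y : rdot x y <= qnorm x * qnorm y.
Proof.
have [x0|x0] := eqVneq (qnorm x) 0.
  rewrite x0 mul0r (qnorm_eq0 x0).
  suff -> : rdot 0 y = 0 by [].
  by apply: (addrI (rdot 0 y)); rewrite -rdotDl !addr0.
have [y0|y0] := eqVneq (qnorm y) 0.
  rewrite y0 mulr0 (qnorm_eq0 y0) rdotC.
  suff -> : rdot 0 x = 0 by [].
  by apply: (addrI (rdot 0 x)); rewrite -rdotDl !addr0.
have px : 0 < qnorm x by rewrite lt_def x0 qnorm_ge0.
have py : 0 < qnorm y by rewrite lt_def y0 qnorm_ge0.
(* Cauchy-Schwarz: with these weights the square norm factors as 2|x||y|(|x||y| - x.y), and both
   norms are now positive. *)
have := rdotxx_ge0 (csm (qnorm y, 0) x + csm (- qnorm x, 0) y).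
rewrite !(rdotDl, rdotDr) !rdotZr !(rdotC (csm _ _)) !rdotZr (rdotC y x) -!qnormE.
move=> h; have : 0 <= 2 * (qnorm x * qnorm y) * (qnorm x * qnorm y - rdot x y).
  by apply: le_trans h _; rewrite le_eqVlt; apply/orP; left; apply/eqP; ring.
by rewrite pmulr_rge0 ?subr_ge0 // !mulr_gt0.
Qed.

Lemma qnormD x y : qnorm (x + y) <= qnorm x + qnorm y.
Proof.
rewrite -(ler_pXn2r (n := 2)) ?nnegrE ?addr_ge0 ?qnorm_ge0 //.
rewrite sqrrD !qnormE !(rdotDl, rdotDr) (rdotC y x).
by have := rdot_le x y; lra.
Qed.

Lemma qnormN x : qnorm (- x) = qnorm x.
Proof.
rewrite -[in LHS](csm1 x) -csm_opp qnormZ /cnorm2 /= oppr0.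
by rewrite expr0n addr0 sqrrN expr1n sqrtr1 mul1r.
Qed.

Lemma qnorm_sub x y : qnorm x - qnorm y <= qnorm (x + y).
Proof.
rewrite lerBlDr; apply: le_trans (_ : qnorm (x + y - y) <= _).
  by rewrite addrK.
by rewrite -[qnorm y]qnormN qnormD.
Qed.

End RealStructure.

(** * Polynomials with vector coefficients and Cauchy's estimates *)

Section VectorPolynomials.
Variables (R : realType) (H : qhilbert R).
Implicit Types (x y z : H) (l m : R * R) (s t : seq H).

(** Horner's scheme, constant coefficient first; trailing zero coefficients are allowed. *)
Fixpoint peval s l : H := if s is x :: s' then x + csm l (peval s' l) else 0.

Fixpoint padd s t : seq H :=
  match s, t with
  | [::], _ => t
  | _, [::] => s
  | x :: s', y :: t' => (x + y) :: padd s' t'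
  end.

Lemma peval_padd s t l : peval (padd s t) l = peval s l + peval t l.
Proof.
elim: s t => [|x s IH] [|y t] /=; rewrite ?add0r ?addr0 //.
by rewrite IH csmD addrACA.
Qed.

Lemma nth_padd s t i : nth 0 (padd s t) i = nth 0 s i + nth 0 t i.
Proof. by elim: s t i => [|x s IH] [|y t] [|i] //=; rewrite ?add0r ?addr0 ?nth_nil. Qed.

Fixpoint pevens s : seq H :=
  match s with
  | x :: _ :: s' => x :: pevens s'
  | _ => s
  end.

Lemma pevens_cons x s : pevens (x :: s) = x :: pevens (behead s).
Proof. by case: s. Qed.

(** The two bounds are proved together because prepending a coefficient exchanges the even and odd
    parts. *)
Lemma size_pevens s : (size (pevens s) <= size s)%N /\
  (size (pevens (behead s)) <= (size s).-1)%N.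
Proof.
elim: s => [//|x s [h1 h2]]; split => //.
by rewrite pevens_cons /=; apply: leq_ltn_trans h2 _; case: (size s).
Qed.

Definition csqr l : R * R := (l.1 * l.1 - l.2 * l.2, l.1 * l.2 + l.2 * l.1).

(** The splitting p(l) = e(l^2) + l o(l^2). Prepending a coefficient turns e into the new odd part
    and l o(l^2) into a term of the new even part. *)
Lemma peval_evens s l : peval s l =
  peval (pevens s) (csqr l) + csm l (peval (pevens (behead s)) (csqr l)).
Proof.
elim: s => [|x s IH]; first by rewrite /= csm0 addr0.
by rewrite pevens_cons /= [in LHS]IH csmD csmA -addrA [csm (csqr _) _ + _]addrC.
Qed.

Lemma csqrt_exists l : exists2 m, csqr m = l & cnorm2 m = Num.sqrt (cnorm2 l).
Proof.
case: l => a b; set r := Num.sqrt _.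
have r2 : r ^+ 2 = a ^+ 2 + b ^+ 2.
  by rewrite sqr_sqrtr // addr_ge0 ?sqr_ge0.
have r0 : 0 <= r by apply: sqrtr_ge0.
have ar : `|a| <= r.
  by rewrite -sqrtr_sqr ler_sqrt ?lerDl ?sqr_ge0 // addr_ge0 ?sqr_ge0.
have [ar1 ar2] : - r <= a /\ a <= r by apply/andP; rewrite -ler_norml.
(* Half-angle formulas; both radicands are non-negative since |a| <= r, and the imaginary part takes
   the sign of [b]. *)
pose u := Num.sqrt ((r + a) / 2); pose v := Num.sqrt ((r - a) / 2).
have u2 : u ^+ 2 = (r + a) / 2 by rewrite sqr_sqrtr //; lra.
have v2 : v ^+ 2 = (r - a) / 2 by rewrite sqr_sqrtr //; lra.
have uv : 2 * (u * v) = `|b|.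
  apply: (@pexpIrn _ 2) => //; rewrite ?nnegrE ?mulr_ge0 ?sqrtr_ge0 //.
  rewrite real_normK ?num_real // !exprMn u2 v2.
  have -> : b ^+ 2 = r ^+ 2 - a ^+ 2 by rewrite r2; ring.
  by field.
exists (u, if 0 <= b then v else - v).
  rewrite /csqr /=; congr pair.
    by case: ifP => _; rewrite ?mulrNN -!expr2 u2 v2; field.
  case: ifP => [b0|/negbT]; first by rewrite -(ger0_norm b0) -uv; ring.
  by rewrite -ltNge => b0; rewrite -[b]opprK -(ltr0_norm b0) -uv; ring.
by rewrite /cnorm2 /=; case: ifP => _; rewrite ?sqrrN u2 v2; field.
Qed.

Lemma cnorm2_csqr l : cnorm2 (csqr l) = cnorm2 l ^+ 2.
Proof. by rewrite /cnorm2 /csqr /=; ring. Qed.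

Lemma qnorm_double x : qnorm (x + x) = 2 * qnorm x.
Proof.
rewrite -[in LHS](csm1 x) csmDl qnormZ /cnorm2 /= addr0 expr0n addr0.
by rewrite sqrtr_sqr ger0_norm ?addr_ge0.
Qed.

Lemma peval_opp s l : peval s (copp l) =
  peval (pevens s) (csqr l) - csm l (peval (pevens (behead s)) (csqr l)).
Proof.
rewrite peval_evens csm_opp.
by have -> : csqr (copp l) = csqr l by rewrite /csqr /= !mulrNN.
Qed.

Lemma cnorm2_opp l : cnorm2 (copp l) = cnorm2 l.
Proof. by rewrite /cnorm2 /= !sqrrN. Qed.

(** Since p(k) + p(-k) = 2 e(k^2), the even part obeys the same bound on the circle of squared
    radius. It keeps the constant coefficient and is shorter once there are two coefficients, so
    induction on the length applies. Here [r] is the squared modulus. *)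
Lemma peval0_bound s (r B : R) : 0 < r ->
  (forall l, cnorm2 l = r -> qnorm (peval s l) <= B) -> qnorm (nth 0 s 0) <= B.
Proof.
have [n] := ubnP (size s); elim: n s r => // n IH s r sn r0 hB.
case: s sn hB => [|x [|y s]] /= sn hB.
- by apply: (hB (Num.sqrt r, 0)); rewrite /cnorm2 /= sqr_sqrtr ?ltW // expr0n addr0.
- have := hB (Num.sqrt r, 0); rewrite csm0 addr0; apply.
  by rewrite /cnorm2 /= sqr_sqrtr ?ltW // expr0n addr0.
apply: (IH (pevens [:: x, y & s]) (r ^+ 2)).
- move: sn; rewrite ltnS; apply: leq_trans.
  by rewrite !ltnS; case: (size_pevens s).
- by rewrite exprn_gt0.
move=> l lr; have [k kl kr] := csqrt_exists l; rewrite -kl.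
rewrite lr sqrtr_sqr gtr0_norm // in kr.
have h1 := hB _ kr; have := hB (copp k).
rewrite cnorm2_opp => /(_ kr); rewrite -[_ + _]/(peval [:: x, y & s] _) peval_opp.
rewrite -[_ + _]/(peval [:: x, y & s] _) peval_evens in h1 => h2.
have := le_trans (qnormD _ _) (lerD h1 h2).
by rewrite addrACA subrr addr0 qnorm_double; lra.
Qed.

(** Since p(k) - p(-k) = 2 k o(k^2), the odd part is bounded by [B / r], and its constant
    coefficient is the linear one of [s]. Here [r] is the modulus itself. *)
Lemma peval1_bound s (r B : R) : 0 < r ->
  (forall l, cnorm2 l = r ^+ 2 -> qnorm (peval s l) <= B) ->
  r * qnorm (nth 0 s 1) <= B.
Proof.
move=> r0 hB; rewrite mulrC -ler_pdivlMr //.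
have -> : nth 0 s 1 = nth 0 (pevens (behead s)) 0.
  by case: s {hB} => [|x [|y s]] //; rewrite pevens_cons.
apply: (@peval0_bound _ ((r ^+ 2) ^+ 2)); first by rewrite !exprn_gt0.
move=> l lr; have [k kl kr] := csqrt_exists l; rewrite -kl.
rewrite lr sqrtr_sqr gtr0_norm ?exprn_gt0 // in kr.
have h1 := hB _ kr; have := hB (copp k).
rewrite cnorm2_opp => /(_ kr); rewrite peval_opp -qnormN opprB => h2.
rewrite peval_evens addrC in h1.
have := le_trans (qnormD _ _) (lerD h1 h2).
rewrite addrACA subrr addr0 qnorm_double qnormZ kr sqrtr_sqr gtr0_norm //.
by rewrite ler_pdivlMr //; lra.
Qed.

End VectorPolynomials.

(** * Operators of the form 1 + lT, and polynomials built from them *)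

Section Shears.
Variables (R : realType) (H : qhilbert R).
Implicit Types (x y z : H) (l m : R * R) (s : seq H) (T P Q : H -> H).

Definition clinear T : Prop :=
  (forall x y, T (x + y) = T x + T y) /\ (forall l x, T (csm l x) = csm l (T x)).

Lemma bounded_rlinear_clinear T : bounded_rlinear T -> clinear T.
Proof. by move=> [TD [TZ _]]; split=> // l x; apply: TZ. Qed.

(** Raising the constant to at least 1 makes it positive, so that it can be divided by. *)
Lemma bounded_rlinear_bound T : bounded_rlinear T ->
  exists2 C : R, 1 <= C & forall x, qnorm (T x) <= C * qnorm x.
Proof.
move=> [_ [_ [C hC]]]; exists (Num.max 1 C); first by rewrite le_max lexx.
move=> x; apply: le_trans (hC x) _; rewrite ler_wpM2r ?qnorm_ge0 //.
by rewrite le_max lexx orbT.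
Qed.

Lemma clinear0 T : clinear T -> T 0 = 0.
Proof. by move=> [TD _]; apply: (addrI (T 0)); rewrite -TD !addr0. Qed.

Lemma clinearN T x : clinear T -> T (- x) = - T x.
Proof.
by move=> linT; apply: (addrI (T x)); rewrite -(proj1 linT) !subrr clinear0.
Qed.

Lemma clinear_opp T : clinear T -> clinear (fun x => - T x).
Proof.
by move=> [TD TZ]; split=> [x y|l x]; rewrite ?TD ?opprD // TZ csmN.
Qed.

Definition shear T l x : H := x + csm l (T x).

Lemma clinear_shear T l : clinear T -> clinear (shear T l).
Proof.
move=> [TD TZ]; rewrite /shear; split=> [x y|m x].
  by rewrite TD csmD addrACA.
by rewrite TZ csmD csmC.
Qed.

Lemma shear_intertwine T P Q l x : clinear T -> P \o T = T \o Q ->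
  shear P l (T x) = T (shear Q l x).
Proof.
move=> [TD TZ] PTQ; rewrite /shear TD TZ; congr (_ + csm _ _).
exact: (congr1 (@^~ x) PTQ).
Qed.

(** Commutation is intertwining of an operator with itself, so [shear_intertwine] applies twice,
    once for each shear. *)
Lemma shear_comm P Q l m : clinear P -> clinear Q -> P \o Q = Q \o P ->
  shear P l \o shear Q m = shear Q m \o shear P l.
Proof.
move=> linP linQ PQ; apply/funext => x /=.
have linS := clinear_shear m linQ.
rewrite (@shear_intertwine _ _ P) //; apply/funext => y /=.
by rewrite -(@shear_intertwine P Q Q).
Qed.

Lemma iter_intertwine P Q T n x : P \o T = T \o Q ->
  iter n P (T x) = T (iter n Q x).
Proof.
move=> PT; elim: n => //= n ->.
exact: (congr1 (@^~ (iter n Q x)) PT).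
Qed.

(** After expanding both squares, the cross terms agree by adjointness and the quadratic terms
    because normality gives |Ts x| = |T x|. *)
Lemma normal_op_qnorm_shear T Ts l x :
  clinear T -> is_adjoint T Ts -> normal_op T Ts ->
  qnorm (shear Ts l x) = qnorm (shear T (cconj l) x).
Proof.
move=> [TD TZ] adjT nT; apply: eq_qnorm.
have adj y z : rdot (T y) z = rdot y (Ts z) by rewrite /rdot adjT.
rewrite /shear !(rdotDl, rdotDr) !rdotZ ![rdot (csm _ _) x]rdotC.
have -> : rdot x (csm (cconj l) (T x)) = rdot x (csm l (Ts x)).
  by rewrite rdotC -TZ adj rdotZl /cconj /= opprK -surjective_pairing.
have -> : rdot (Ts x) (Ts x) = rdot (T x) (T x).
  rewrite -adj rdotC [T (Ts x)](congr1 (@^~ x) nT) /= -adj //.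
by rewrite /cnorm2 /= sqrrN.
Qed.

(** This replaces exp(A) exp(-A) = 1: the first-order terms cancel and the error is of order
    |l|^2. *)
Lemma shear_opp T l x : clinear T ->
  shear T l (shear T (copp l) x) = x - csm (csqr l) (T (T x)).
Proof.
move=> linT; have [TD TZ] := linT; rewrite /shear csm_opp TD (clinearN _ linT) TZ.
by rewrite csmD csmN csmA addrA subrK.
Qed.

Lemma qnorm_csqr_sqr T (c : R) l x : 0 <= c ->
  (forall y, qnorm (T y) <= c * qnorm y) ->
  qnorm (csm (csqr l) (T (T x))) <= c ^+ 2 * cnorm2 l * qnorm x.
Proof.
move=> c0 hc; have l0 : 0 <= cnorm2 l by rewrite addr_ge0 ?sqr_ge0.
rewrite qnormZ cnorm2_csqr sqrtr_sqr ger0_norm //.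
rewrite [c ^+ 2 * _]mulrC -mulrA ler_wpM2l // expr2 -mulrA.
by apply: le_trans (hc _) _; rewrite ler_wpM2l.
Qed.

Lemma qnorm_shear_opp_le T (c : R) l x : clinear T -> 0 <= c ->
  (forall y, qnorm (T y) <= c * qnorm y) ->
  qnorm (shear T l (shear T (copp l) x)) <= (1 + c ^+ 2 * cnorm2 l) * qnorm x.
Proof.
move=> linT c0 hc; rewrite shear_opp //; apply: le_trans (qnormD _ _) _.
by rewrite mulrDl mul1r lerD2l qnormN qnorm_csqr_sqr.
Qed.

Lemma qnorm_shear_opp_ge T (c : R) l x : clinear T -> 0 <= c ->
  (forall y, qnorm (T y) <= c * qnorm y) ->
  (1 - c ^+ 2 * cnorm2 l) * qnorm x <= qnorm (shear T l (shear T (copp l) x)).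
Proof.
move=> linT c0 hc; rewrite shear_opp //; apply: le_trans (qnorm_sub _ _).
by rewrite mulrBl mul1r lerD2l lerN2 qnormN qnorm_csqr_sqr.
Qed.

Lemma peval_map T s l : clinear T -> peval (map T s) l = T (peval s l).
Proof.
move=> linT; elim: s => [|x s IH] /=; first by rewrite clinear0.
by rewrite IH (proj1 linT) (proj2 linT).
Qed.

(** The coefficients of (1 + lT) p(l): the prepended 0 accounts for the factor l. *)
Definition pshear T s : seq H := padd s (0 :: map T s).

Lemma peval_pshear T s l : clinear T ->
  peval (pshear T s) l = shear T l (peval s l).
Proof. by move=> linT; rewrite peval_padd /= add0r peval_map. Qed.

Lemma peval_iter_pshear T s l n : clinear T ->
  peval (iter n (pshear T) s) l = iter n (shear T l) (peval s l).
Proof. by move=> linT; elim: n => //= n <-; rewrite peval_pshear. Qed.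

Lemma nth_map0 T s i : T 0 = 0 -> nth 0 (map T s) i = T (nth 0 s i).
Proof.
move=> T0; have [si|si] := ltnP i (size s); first exact: nth_map.
by rewrite !nth_default ?size_map.
Qed.

Lemma nth0_iter_pshear T s n : nth 0 (iter n (pshear T) s) 0 = nth 0 s 0.
Proof. by elim: n => //= n IH; rewrite nth_padd addr0. Qed.

(** Each factor 1 + lT adds T of the constant coefficient to the linear one, and leaves the constant
    one unchanged. *)
Lemma nth1_iter_pshear T s n : T 0 = 0 ->
  nth 0 (iter n (pshear T) s) 1 = nth 0 s 1 + T (nth 0 s 0) *+ n.
Proof.
move=> T0; elim: n => [|n IH]; first by rewrite addr0.
rewrite iterS nth_padd IH [nth _ (_ :: _) _]/= nth_map0 // nth0_iter_pshear.
by rewrite mulrSr addrA.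
Qed.

End Shears.

Lemma expr_1Dx_le2 (R : realType) (a : R) n : 0 <= a -> a *+ n <= 1 / 2 ->
  (1 + a) ^+ n <= 2.
Proof.
move=> a0 an.
(* Inductive step: (1 + a)(1 - (k+1)a) = 1 - ka - (k+1)a^2 <= 1 - ka. *)
have step k : (1 + a) ^+ k * (1 - a *+ k) <= 1.
  elim: k => [|k IH]; first by rewrite mulr0n subr0 mulr1.
  apply: le_trans IH; rewrite exprSr -mulrA ler_wpM2l ?exprn_ge0 ?addr_ge0 //.
  rewrite mulrSr; have : 0 <= a * (a *+ k) by rewrite mulr_ge0 ?mulrn_wge0.
  by have := sqr_ge0 a; nra.
have := step n; have : 0 <= (1 + a) ^+ n by rewrite exprn_ge0 // addr_ge0.
by nra.
Qed.

(** * Rosenblum's argument with powers in place of exponentials *)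

Section FugledePutnam.
Variables (R : realType) (H : qhilbert R).
Variables (T1 T1s T2 T2s S : H -> H).
Hypotheses (linT1 : clinear T1) (linT1s : clinear T1s).
Hypotheses (linT2 : clinear T2) (linT2s : clinear T2s) (linS : clinear S).
Hypotheses (adjT1 : is_adjoint T1 T1s) (adjT2 : is_adjoint T2 T2s).
Hypotheses (nT1 : normal_op T1 T1s) (nT2 : normal_op T2 T2s).
Hypothesis T1S : T1 \o S = S \o T2.
Variables (c d : R).
Hypotheses (c1 : 1 <= c) (d1 : 1 <= d).
Hypotheses (boundT1 : forall x, qnorm (T1 x) <= c * qnorm x).
Hypotheses (boundT2 : forall x, qnorm (T2 x) <= c * qnorm x).
Hypothesis boundS : forall x, qnorm (S x) <= d * qnorm x.

Let c0 : 0 <= c. Proof. exact: le_trans ler01 c1. Qed.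

(** The polynomial stand-in for exp(l T1s) S exp(-l T2s). *)
Definition twist n l (z : H) : H :=
  iter n (shear T1s l) (S (iter n (shear T2s (copp l)) z)).

(** By normality 1 + m T1 passes the shears of [T1s]; [T1S] turns it into 1 + m T2, which passes
    those of [T2s]. *)
Lemma shear_twist n l m z : shear T1 m (twist n l z) = twist n l (shear T2 m z).
Proof.
rewrite /twist.
rewrite -(@iter_intertwine _ _ (shear T1s l)); last first.
  by apply: shear_comm => //; rewrite -nT1.
rewrite (@shear_intertwine _ _ S _ T2) //.
rewrite -(@iter_intertwine _ _ (shear T2s (copp l))) //.
by apply: shear_comm => //; rewrite -nT2.
Qed.

Lemma twistS n l z :
  twist n.+1 l z = shear T1s l (twist n l (shear T2s (copp l) z)).
Proof. by rewrite /twist iterS iterSr. Qed.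

(** Induction on [n]: the base case costs one factor 1 + c^2 |l|^2 and each pair of new shears
    another, whence the exponent [n.+1]. *)
Lemma qnorm_shear_twist_le n l z :
  qnorm (shear T1 (cconj l) (shear T1 (copp (cconj l)) (twist n l z)))
    <= (1 + c ^+ 2 * cnorm2 l) ^+ n.+1 * (d * qnorm z).
Proof.
have nl : cnorm2 (cconj l) = cnorm2 l by rewrite /cnorm2 /= sqrrN.
have k0 : 0 <= 1 + c ^+ 2 * cnorm2 l.
  by rewrite addr_ge0 // mulr_ge0 ?addr_ge0 ?sqr_ge0.
elim: n z => [|n IH] z.
  apply: le_trans (qnorm_shear_opp_le _ _ linT1 c0 boundT1) _.
  by rewrite nl expr1 ler_wpM2l.
(* The outermost 1 + l T1s is moved to the front, exchanged for 1 + conj(l) T1 at equal norm, and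
   then carried through [twist n] to become 1 + conj(l) T2. *)
pose w := shear T2 (cconj l) (shear T2s (copp l) z).
have -> : qnorm (shear T1 (cconj l) (shear T1 (copp (cconj l)) (twist n.+1 l z)))
   = qnorm (shear T1 (cconj l) (shear T1 (copp (cconj l)) (twist n l w))).
  rewrite twistS /w -shear_twist.
  set u := twist _ _ _.
  have comm m y : shear T1 m (shear T1s l y) = shear T1s l (shear T1 m y).
    by apply: (congr1 (@^~ y) (shear_comm _ _ linT1 linT1s nT1)).
  have comm1 m m' y : shear T1 m (shear T1 m' y) = shear T1 m' (shear T1 m y).
    by apply: (congr1 (@^~ y) (shear_comm _ _ linT1 linT1 erefl)).
  rewrite !comm (normal_op_qnorm_shear _ _ linT1 adjT1 nT1).
  by congr qnorm; congr shear; rewrite comm1.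
apply: le_trans (IH w) _; rewrite [_ ^+ n.+2]exprSr -mulrA.
rewrite ler_wpM2l ?exprn_ge0 // mulrCA ler_wpM2l ?(le_trans ler01 d1) //.
have -> : w = shear T2s (copp l) (shear T2 (cconj l) z).
  by apply: (congr1 (@^~ z) (shear_comm _ _ linT2 linT2s nT2)).
(* Normality of [T2] now turns the pair into (1 - conj(l) T2)(1 + conj(l) T2), free of first-order
   terms. *)
rewrite (normal_op_qnorm_shear _ _ linT2 adjT2 nT2) -nl.
have -> : cconj (copp l) = copp (cconj l) by [].
have := congr1 (@^~ z) (shear_comm (copp (cconj l)) (cconj l) linT2 linT2 erefl).
by rewrite /= => ->; apply: qnorm_shear_opp_le.
Qed.

(** With a = c^2 |l|^2 <= 1/2, the lower bound loses a factor 1 - a >= 1/2 and the upper bound has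
    (1 + a)^(n+1) <= 2, whence 4. *)
Lemma qnorm_twist_le n l z : c ^+ 2 * cnorm2 l *+ n.+1 <= 1 / 2 ->
  qnorm (twist n l z) <= 4 * (d * qnorm z).
Proof.
set a := c ^+ 2 * _ => an.
have a0 : 0 <= a by rewrite mulr_ge0 ?addr_ge0 ?sqr_ge0.
have a2 : a <= 1 / 2.
  by apply: le_trans an; rewrite mulrS lerDl mulrn_wge0.
have h1 := qnorm_shear_opp_ge (cconj l) (twist n l z) linT1 c0 boundT1.
have h2 := qnorm_shear_twist_le n l z.
have h3 := expr_1Dx_le2 a0 an.
have nl : cnorm2 (cconj l) = cnorm2 l by rewrite /cnorm2 /= sqrrN.
have h := le_trans h1 h2; rewrite nl -/a in h.
have dz : 0 <= d * qnorm z by rewrite mulr_ge0 ?qnorm_ge0 ?(le_trans ler01 d1).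
have h4 := ler_wpM2r dz h3.
have := qnorm_ge0 (twist n l z).
by nra.
Qed.

Lemma commutator_bound m z :
  m.+1%:R * qnorm (T1s (S z) - S (T2s z)) <= 8 * c * (d * qnorm z).
Proof.
have [n nE] : {n | n = (m.+1 ^ 2)%N} by exists (m.+1 ^ 2)%N.
set D := T1s (S z) - S (T2s z).
pose s := iter n (pshear T1s)
  (map S (iter n (pshear (fun x => - T2s x)) [:: z])).
have linNT2s := clinear_opp linT2s.
have cp : 0 < c by apply: lt_le_trans ltr01 c1.
have m0 : (0 : R) < m.+1%:R by rewrite ltr0n.
have sE l : peval s l = twist n l z.
  rewrite peval_iter_pshear // peval_map // peval_iter_pshear //= csm0 addr0.
  rewrite /twist; congr (iter _ _ (S _)); apply: eq_iter => x.
  by rewrite /shear csm_opp csmN.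
have s1 : nth 0 s 1 = D *+ n.
  have S0 := clinear0 linS; have T1s0 := clinear0 linT1s.
  have NT2s0 := clinear0 linNT2s.
  rewrite nth1_iter_pshear // !nth_map0 // nth1_iter_pshear // nth0_iter_pshear.
  rewrite [nth _ _ 0]/= [nth _ _ 1]/= add0r.
  rewrite mulrnBl addrC; congr (_ + _).
  have SMn x k : S (x *+ k) = S x *+ k.
    elim: k => [|k IH]; first by rewrite clinear0.
    by rewrite !mulrS (proj1 linS) IH.
  by rewrite SMn (clinearN _ linS) mulNrn.
(* With n = (m+1)^2 this radius gives c^2 r^2 (n+1) = (1/(m+1)^2 + 1)/4 <= 1/2, as [qnorm_twist_le]
   requires, while r n = (m+1)/(2c) still grows with m. *)
pose r := (2 * c * m.+1%:R)^-1.
have r0 : 0 < r by rewrite invr_gt0 !mulr_gt0.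
have := @peval1_bound _ _ s r (4 * (d * qnorm z)) r0.
rewrite s1; have -> : qnorm (D *+ n) = m.+1%:R ^+ 2 * qnorm D.
  have -> : D *+ n = csm (n%:R, 0) D.
    elim: (n) => [|k IH]; last first.
      by rewrite mulrS IH -{1}(csm1 D) csmDl addr0 /= mulrS.
    by apply: (addrI (csm (0, 0) D)); rewrite csmDl /= !addr0.
  rewrite qnormZ /cnorm2 /= expr0n addr0 sqrtr_sqr ger0_norm ?ler0n //.
  by rewrite nE natrX.
move=> h; have {h} : r * (m.+1%:R ^+ 2 * qnorm D) <= 4 * (d * qnorm z).
  apply: h => l lr; rewrite sE; apply: qnorm_twist_le.
  rewrite lr -mulr_natr /r.
  have -> : n.+1%:R = 1 + m.+1%:R ^+ 2 :> R by rewrite mulrS nE natrX.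
  have -> : c ^+ 2 * (2 * c * m.+1%:R)^-1 ^+ 2 * (1 + m.+1%:R ^+ 2)
     = (m.+1%:R ^- 2 + 1) / 4.
    by move: (m.+1%:R : R) m0 => M M0; field; rewrite !gt_eqF.
  have : m.+1%:R ^- 2 <= 1 :> R.
    by rewrite invf_le1 ?exprn_gt0 // exprn_ege1 // ler1n.
  by move: (_ ^- 2) => t; lra.
have -> : r * (m.+1%:R ^+ 2 * qnorm D) = m.+1%:R * qnorm D / (2 * c).
  by rewrite /r; move: (m.+1%:R : R) m0 => M M0; field; rewrite !gt_eqF.
rewrite ler_pdivrMr ?mulr_gt0 // => /le_trans; apply.
by rewrite le_eqVlt; apply/orP; left; apply/eqP; ring.
Qed.

Lemma adjoint_intertwine : T1s \o S = S \o T2s.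
Proof.
apply/funext => z /=; apply/eqP; rewrite -subr_eq0; apply/eqP/qnorm_eq0.
set D := _ - _; have D0 := qnorm_ge0 D.
apply/eqP; rewrite eq_le D0 andbT leNgt; apply/negP => Dp.
(* If D were nonzero, [commutator_bound] would give m+1 <= B for every m, which fails at the integer
   part of B. *)
pose B := 8 * c * (d * qnorm z) / qnorm D.
have := commutator_bound (Num.trunc B) z.
rewrite -/D -ler_pdivlMr // -/B leNgt => /negP; apply.
exact: truncnS_gt.
Qed.

End FugledePutnam.

Theorem mainTheorem8 (R : realType) (H : qhilbert R)
  (T1 T1s T2 T2s S : H -> H) :
  bounded_rlinear T1 -> bounded_rlinear T1s -> is_adjoint T1 T1s ->
  bounded_rlinear T2 -> bounded_rlinear T2s -> is_adjoint T2 T2s ->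
  normal_op T1 T1s -> normal_op T2 T2s ->
  bounded_rlinear S ->
  T1 \o S = S \o T2 ->
  T1s \o S = S \o T2s.
Proof.
move=> b1 b1s adj1 b2 b2s adj2 n1 n2 bS T1S.
have [c1 c1_ge1 h1] := bounded_rlinear_bound b1.
have [c2 c2_ge1 h2] := bounded_rlinear_bound b2.
have [d d_ge1 hS] := bounded_rlinear_bound bS.
(* The maximum serves as a common bound for [T1] and [T2]. *)
apply: (@adjoint_intertwine R H T1 T1s T2 T2s S _ _ _ _ _ adj1 adj2 n1 n2 T1S
  (Num.max c1 c2) d) => //; try exact: bounded_rlinear_clinear.
- by rewrite le_max c1_ge1.
- move=> x; apply: le_trans (h1 x) _.
  by rewrite ler_wpM2r ?qnorm_ge0 // le_max lexx.
- move=> x; apply: le_trans (h2 x) _.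
  by rewrite ler_wpM2r ?qnorm_ge0 // le_max lexx orbT.
Qed.
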